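(* For every integer $k\geq 2$, there exists an $(\mathrm L^\infty,\exp)$-integrable orbit equivalence coupling from $\mathbb Z/k\mathbb Z\wr\mathbb Z$ to the Baumslag–Solitar group $\mathrm{BS}(1,k)$.
   Context: $\mathbb Z/k\mathbb Z\wr \mathbb Z=\left(\bigoplus_{\mathbb Z}\mathbb Z/k\mathbb Z\right)\rtimes \mathbb Z$, with $\mathbb Z$ acting by shift; $\mathrm{BS}(1,k)\cong\mathbb Z[1/k]\rtimes\mathbb Z$, where a generator of $\mathbb Z$ acts on $\mathbb Z[1/k]$ by multiplication by $k$. An orbit equivalence coupling from $\Gamma=\langle S_\Gamma\rangle$ to $\Lambda=\langle S_\Lambda\rangle$ ($S_\Gamma,S_\Lambda$ finite symmetric) is a standard probability space $(X,\mu)$ with free (up to null sets) measure-preserving actions of $\Gamma$ and $\Lambda$ such that $\Gamma\cdot x=\Lambda\cdot x$ for almost every $x\in X$. For $y\in\Lambda\cdot x$, $d_{S_\Lambda}(x,y)$ is the minimal word length of $\lambda\in\Lambda$ with $y=\lambda\cdot x$; $d_{S_\Gamma}$ is defined similarly. The coupling is $(\mathrm L^\infty,\exp)$-integrable if for every $\gamma\in\Gamma$ the function $x\mapsto d_{S_\Lambda}(x,\gamma\cdot x)$ is essentially bounded, and for every $\lambda\in\Lambda$ there is $c_\lambda>0$ with $\int_X\exp\left(d_{S_\Gamma}(x,\lambda\cdot x)/c_\lambda\right)d\mu(x)<\infty$. *)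

(* Defs.v *)
From HB Require Import structures.
From mathcomp Require Import all_boot all_order all_algebra.
From mathcomp Require Import all_classical all_reals all_analysis ess_sup_inf.

Set Implicit Arguments.
Unset Strict Implicit.
Unset Printing Implicit Defensive.

Import Order.TTheory GRing.Theory Num.Theory.
Import numFieldNormedType.Exports.

Local Open Scope classical_set_scope.
Local Open Scope ring_scope.

(* An action of the group Z on the abelian group A by automorphisms. *)
Record Zaction (A : zmodType) := MkZaction {
  zact :> int -> A -> A ;
  zactD : forall n, {morph zact n : x y / x + y} ;
  zact0 : forall x, zact 0 x = x ;
  zactM : forall m n x, zact (m + n) x = zact m (zact n x) }.

Definition sdprodZ (A : zmodType) (u : Zaction A) : Type := (A * int)%type.

Section SdprodZ.
Variables (A : zmodType) (u : Zaction A).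
Implicit Types x y : sdprodZ u.

Definition sdprodZ_one : sdprodZ u := (0, 0).
Definition sdprodZ_mul x y : sdprodZ u := (x.1 + u x.2 y.1, x.2 + y.2).
Definition sdprodZ_inv x : sdprodZ u := (- u (- x.2) x.1, - x.2).

Let zact_0 n : u n 0 = 0.
Proof. by apply: (addIr (u n 0)); rewrite -zactD !add0r. Qed.

Fact sdprodZ_mulA : associative sdprodZ_mul.
Proof.
by move=> [a m] [b n] [c p]; rewrite /sdprodZ_mul /= zactD zactM !addrA.
Qed.

Fact sdprodZ_mul1 : left_id sdprodZ_one sdprodZ_mul.
Proof. by move=> [a m]; rewrite /sdprodZ_mul /= zact0 !add0r. Qed.

Fact sdprodZ_1mul : right_id sdprodZ_one sdprodZ_mul.
Proof. by move=> [a m]; rewrite /sdprodZ_mul /= zact_0 !addr0. Qed.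

Fact sdprodZ_mulV : left_inverse sdprodZ_one sdprodZ_inv sdprodZ_mul.
Proof. by move=> [a m]; rewrite /sdprodZ_mul /= !addNr. Qed.

Fact sdprodZ_Vmul : right_inverse sdprodZ_one sdprodZ_inv sdprodZ_mul.
Proof.
move=> [a m]; rewrite /sdprodZ_mul /= subrr; congr (_, _).
have zactN z : u m (- z) = - u m z.
  by apply: (addrI (u m z)); rewrite -zactD !subrr.
by rewrite zactN -zactM subrr zact0 subrr.
Qed.

HB.instance Definition _ := Choice.copy (sdprodZ u) (A * int)%type.
HB.instance Definition _ := isGroup.Build (sdprodZ u)
  sdprodZ_mulA sdprodZ_mul1 sdprodZ_1mul sdprodZ_mulV sdprodZ_Vmul.

End SdprodZ.

(* The additive group of Z/k is ['Z_k], which is only Z/k for 1 < k. *)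
Definition finsupp_pred (k : nat) : {pred int -> 'Z_k} :=
  [pred f | `[< finite_set [set i | f i != 0] >]].

Fact finsupp_zmod_closed k : zmod_closed (@finsupp_pred k).
Proof.
split=> [|f g].
  by apply/asboolP; rewrite (_ : [set _ | _] = set0) // -subset0 => i /= /eqP.
move=> /asboolP ff /asboolP fg; apply/asboolP.
apply: (@sub_finite_set _ _ ([set i | f i != 0] `|` [set i | g i != 0])).
  move=> i /=; case: (eqVneq (f i) 0) => [fi0|]; last by left.
  case: (eqVneq (g i) 0) => [gi0|]; last by right.
  by rewrite -[(f - g) i]/(f i - g i) fi0 gi0 subrr eqxx.
by rewrite finite_setU.
Qed.

HB.instance Definition _ k := GRing.isZmodClosed.Build (int -> 'Z_k)
  (@finsupp_pred k) (@finsupp_zmod_closed k).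

(* The direct sum of copies of Z/k indexed by Z. *)
Record lamps (k : nat) := Lamps {
  lamps_val :> int -> 'Z_k ; _ : lamps_val \in @finsupp_pred k }.

HB.instance Definition _ k := [isSub for @lamps_val k].
HB.instance Definition _ k := [Choice of lamps k by <:].
HB.instance Definition _ k := [SubChoice_isSubZmodule of lamps k by <:].

Fact lamp_shift_subproof k (n : int) (f : lamps k) :
  (fun i => f (i - n)) \in @finsupp_pred k.
Proof.
apply/asboolP; case: f => f /= /asboolP ff.
apply: (@sub_finite_set _ _ ((fun i => i + n) @` [set i | f i != 0])).
  by move=> i /= fi; exists (i - n); rewrite ?subrK.
exact: finite_image.
Qed.

Definition lamp_shift k (n : int) (f : lamps k) : lamps k :=
  Lamps (lamp_shift_subproof n f).

Fact lamp_shiftD k n : {morph @lamp_shift k n : f g / f + g}.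
Proof. by move=> f g; apply/val_inj/funext. Qed.

Fact lamp_shift0 k (f : lamps k) : lamp_shift 0 f = f.
Proof. by apply/val_inj/funext => i /=; rewrite subr0. Qed.

Fact lamp_shiftM k m n (f : lamps k) : lamp_shift (m + n) f = lamp_shift m (lamp_shift n f).
Proof. by apply/val_inj/funext => i /=; rewrite opprD addrA. Qed.

(* The restricted wreath product of Z/k by Z. *)
Definition lamplighter (k : nat) : groupType :=
  sdprodZ (MkZaction (@lamp_shiftD k) (@lamp_shift0 k) (@lamp_shiftM k)).

(* Z[1/k] as an additive subgroup of the rationals. *)
Definition Zinv_pred (k : nat) : {pred rat} :=
  [pred x | `[< exists n : nat, x * k%:R ^+ n \is a Num.int >]].

Fact Zinv_zmod_closed k : zmod_closed (Zinv_pred k).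
Proof.
split=> [|x y]; first by apply/asboolP; exists 0%N; rewrite mul0r rpred0.
move=> /asboolP[m xm] /asboolP[n yn]; apply/asboolP; exists (m + n)%N.
have kint p : (k%:R : rat) ^+ p \is a Num.int by rewrite rpredX ?rpred_nat.
have -> : (x - y) * k%:R ^+ (m + n) =
    x * k%:R ^+ m * k%:R ^+ n - y * k%:R ^+ n * k%:R ^+ m.
  by rewrite mulrBl exprD -!mulrA; congr (_ - y * _); rewrite mulrC.
by apply: rpredB; apply: rpredM.
Qed.

HB.instance Definition _ k := GRing.isZmodClosed.Build rat
  (Zinv_pred k) (Zinv_zmod_closed k).

Record Zinv (k : nat) := MkZinv {
  Zinv_val :> rat ; _ : Zinv_val \in Zinv_pred k }.

HB.instance Definition _ k := [isSub for @Zinv_val k].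
HB.instance Definition _ k := [Choice of Zinv k by <:].
HB.instance Definition _ k := [SubChoice_isSubZmodule of Zinv k by <:].

Fact kpow_subproof k (hk : (1 < k)%N) (n : int) (x : Zinv k) :
  k%:R ^ n * (x : rat) \in Zinv_pred k.
Proof.
have k0 : k%:R != 0 :> rat by rewrite pnatr_eq0 -lt0n ltnW.
have kint p : (k%:R : rat) ^+ p \is a Num.int by rewrite rpredX ?rpred_nat.
case: x => x /= /asboolP[m xm]; apply/asboolP.
case: n => n; [exists m | exists (n.+1 + m)%N].
  by rewrite -mulrA rpredM //= kint.
by rewrite NegzE exprD mulrACA -exprnN mulVf ?expf_neq0 // mul1r.
Qed.

Definition kpow k (hk : (1 < k)%N) (n : int) (x : Zinv k) : Zinv k :=
  MkZinv (kpow_subproof hk n x).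

Fact kpowD k (hk : (1 < k)%N) n : {morph kpow hk n : x y / x + y}.
Proof. by move=> x y; apply/val_inj; rewrite /= mulrDr. Qed.

Fact kpow0 k (hk : (1 < k)%N) (x : Zinv k) : kpow hk 0 x = x.
Proof. by apply/val_inj; rewrite /= expr0z mul1r. Qed.

Fact kpowM k (hk : (1 < k)%N) m n (x : Zinv k) :
  kpow hk (m + n) x = kpow hk m (kpow hk n x).
Proof.
by apply/val_inj; rewrite /= expfzDr ?mulrA // pnatr_eq0 -lt0n ltnW.
Qed.

(* BS(1, k) = <a, t | t a t^-1 = a^k> in its affine form, the semidirect product
   of Z[1/k] and Z, with a = (1, 0) and t = (0, 1). *)
Definition BS1 (k : nat) (hk : (1 < k)%N) : groupType :=
  sdprodZ (MkZaction (kpowD hk) (kpow0 hk) (kpowM hk)).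

Definition is_word (G : groupType) (S : set G) (g : G) (w : seq G) : Prop :=
  [set` w] `<=` S /\ (\big[*%g/1%g]_(s <- w) s = g).

Definition finite_sym_generating (G : groupType) (S : set G) : Prop :=
  [/\ finite_set S,
      forall s, S s -> S (s^-1)%g &
      forall g, exists w, is_word S g w].

(* An infimum of natural numbers in the extended reals: the minimum if there is
   a word, +oo otherwise. *)
Definition word_length (R : realType) (G : groupType) (S : set G) (g : G)
    : \bar R :=
  ereal_inf [set (size w)%:R%:E | w in is_word S g].

(* The sigma-algebra is the Borel sigma-algebra of a Polish (separable,
   completely metrizable) topology. *)
Definition standard_borel (R : realType) (d : measure_display)
    (X : measurableType d) : Prop :=
  exists (P : completePseudoMetricType R) (f : X -> P),
    [/\ hausdorff_space P,
        exists2 D : set P, countable D & dense D,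
        bijective f &
        @measurable d X = [set f @^-1` B | B in <<s @open P >>]].

Section OrbitEquivalence.
Variables (R : realType) (d : measure_display) (X : measurableType d).
Variable mu : probability X R.

Definition free_pmp_action (G : groupType) (a : G -> X -> X) : Prop :=
  [/\ forall x, a 1%g x = x,
      forall g h x, a (g * h)%g x = a g (a h x),
      forall g, measurable_fun setT (a g),
      forall g A, measurable A -> pushforward mu (a g) A = mu A &
      \forall x \ae mu, forall g, a g x = x -> g = 1%g].

Definition action_orbit (G : groupType) (a : G -> X -> X) (x : X) : set X :=
  [set a g x | g in setT].

Definition OE_coupling (G L : groupType) (aG : G -> X -> X) (aL : L -> X -> X)
    : Prop :=
  [/\ standard_borel R X, free_pmp_action aG, free_pmp_action aL &
      \forall x \ae mu, action_orbit aG x = action_orbit aL x].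

(* The distance d_S(x, y) on orbits; it is +oo if y is not in the orbit of x,
   which matters only on a null set below. *)
Definition orbit_dist (G : groupType) (S : set G) (a : G -> X -> X) (x y : X)
    : \bar R :=
  ereal_inf [set word_length R S g | g in [set g | y = a g x]].

Definition Linfty_exp_integrable (G L : groupType) (SG : set G) (SL : set L)
    (aG : G -> X -> X) (aL : L -> X -> X) : Prop :=
  (forall g : G, (ess_sup mu (fun x => orbit_dist SL aL x (aG g x)) < +oo)%E) /\
  (forall l : L, exists2 c : R, 0 < c &
     (\int[mu]_x expeR (orbit_dist SG aG x (aL l x) * (c^-1)%:E) < +oo)%E).

End OrbitEquivalence.

(* Main.v *)
(* Both groups act on the Bernoulli space X = (Z/k)^Z: the lamplighter group by
   translations and shifts, and BS(1,k) by the same shift together with the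
   k-adic odometer, where q in Z[1/k] is added to a digit sequence with carries.
   For almost every x the carries stop, so adding q changes finitely many
   digits, and two sequences differing in finitely many digits differ by some q:
   the orbits coincide.  On such x the odometer is a countable piecewise
   translation, hence preserves the measure.  Changing fixed lamps amounts to
   adding one of finitely many q, whence the L^oo bound; conversely the number
   of digits changed by adding q has a geometric tail, and the length of a lamp
   configuration is at most affine in the size of its support. *)

Require Import Defs.
From HB Require Import structures.
From mathcomp Require Import all_boot all_order all_algebra.
From mathcomp Require Import all_classical all_reals all_analysis.
From mathcomp Require Import measurable_realfun ess_sup_inf.
From mathcomp Require Import zify ring lra.

Set Implicit Arguments.
Unset Strict Implicit.
Unset Printing Implicit Defensive.

Import Order.TTheory GRing.Theory Num.Theory.
Import numFieldNormedType.Exports.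

Local Open Scope classical_set_scope.
Local Open Scope ring_scope.

(** * Enumeration of the integers as 0, -1, 1, -2, 2, .. *)

Definition int_of_pos (n : nat) : int :=
  if odd n then Negz n./2 else Posz n./2.

Definition pos_of_int (i : int) : nat :=
  match i with Posz n => n.*2 | Negz n => n.*2.+1 end.

Lemma pos_of_intK : cancel pos_of_int int_of_pos.
Proof.
by case=> n; rewrite /int_of_pos /= odd_double /= ?doubleK // uphalf_double.
Qed.

Lemma int_of_posK : cancel int_of_pos pos_of_int.
Proof.
move=> n; rewrite /int_of_pos -[RHS]odd_double_half.
by case: (odd n).
Qed.

(** * The space of bi-infinite digit sequences *)

Section Cylinders.
Variable k : nat.
Implicit Types (x y : int -> 'Z_k) (s : seq 'Z_k).

Definition agree n x y :=
  forall i, (i < n)%N -> x (int_of_pos i) = y (int_of_pos i).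

Definition initial n x : seq 'Z_k := mkseq (fun i => x (int_of_pos i)) n.

(** The default value of [nth] pads the word with zeros, which gives a chosen point of
    [cylinder s]. *)
Definition extend s (i : int) : 'Z_k := s`_(pos_of_int i).

Definition cylinder s : set (int -> 'Z_k) := [set x | initial (size s) x = s].

Lemma initialP n x y : initial n x = initial n y <-> agree n x y.
Proof.
split=> [xy i ilt|xy]; last by apply/eq_in_map => i; rewrite mem_iota => /xy.
by have := congr1 (fun s => s`_i) xy; rewrite !nth_mkseq.
Qed.

Lemma size_initial n x : size (initial n x) = n.
Proof. by rewrite size_mkseq. Qed.

Lemma initial_extend s : initial (size s) (extend s) = s.
Proof.
apply: (@eq_from_nth _ 0) => [|i]; rewrite size_initial // => ilt.
by rewrite nth_mkseq // /extend int_of_posK.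
Qed.

Lemma cylinder_initial n x y : cylinder (initial n x) y <-> agree n x y.
Proof. by rewrite /cylinder /= size_initial; rewrite initialP; split=> + i => /[apply]. Qed.

Definition cylinders : set (set (int -> 'Z_k)) := [set cylinder s | s in setT] `|` [set set0].

(** Cylinders prescribe initial segments of one enumeration, so two of them are nested or disjoint;
    the empty set belongs to [cylinders] for the second case. *)
Lemma cylinders_setI : setI_closed cylinders.
Proof.
have sub s t x : (size s <= size t)%N -> cylinder s x -> cylinder t x ->
    cylinder s `&` cylinder t = cylinder t.
  move=> st xs xt; apply: setIidr => y yt; apply: etrans xs; apply/initialP.
  have /initialP yx : initial (size t) y = initial (size t) x by exact: etrans (esym xt).
  by move=> i ilt; apply: yx; exact: leq_trans ilt st.
move=> _ _ [[s _ <-]|->] [[t _ <-]|->]; try by right; rewrite ?set0I ?setI0.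
have [[x [xs xt]]|/set0P/negP/negPn/eqP ->] := pselect (cylinder s `&` cylinder t !=set0);
  last by right.
left; have [le|/ltnW le] := leqP (size s) (size t).
  by exists t => //; rewrite (sub _ _ _ le xs xt).
by exists s => //; rewrite setIC (sub _ _ _ le xt xs).
Qed.

End Cylinders.

(* [R] is a phantom: it is the type in which the distances take their values. *)
Definition cfg (R : realType) (k : nat) : Type := int -> 'Z_k.

HB.instance Definition _ R k := Choice.copy (cfg R k) (int -> 'Z_k).
HB.instance Definition _ R k := isPointed.Build (cfg R k) (fun=> 0).

(** * The Polish topology of digit sequences *)

Section Topology.
Variables (R : realType) (k : nat).
Local Notation X := (cfg R k).
Implicit Types (x y z : X) (s : seq 'Z_k).

(** Two points are [e]-close when they agree at all indices below 1/e. The clause [0 < e] empties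
    the balls of non-positive radius, without which the triangle inequality would fail for such
    radii. *)
Definition cfg_ball x (e : R) y :=
  0 < e /\ forall i, i%:R < e^-1 -> x (int_of_pos i) = y (int_of_pos i).

Let cfg_ball_center x e : 0 < e -> cfg_ball x e x.
Proof. by []. Qed.

Let cfg_ball_sym x y e : cfg_ball x e y -> cfg_ball y e x.
Proof. by case=> e0 xy; split=> // i /xy. Qed.

Let cfg_ball_triangle x y z e1 e2 :
  cfg_ball x e1 y -> cfg_ball y e2 z -> cfg_ball x (e1 + e2) z.
Proof.
move=> [e10 xy] [e20 yz]; split=> [|i ilt]; first exact: addr_gt0.
have lt e : 0 < e -> e <= e1 + e2 -> i%:R < e^-1.
  by move=> e0 le_e; apply: lt_le_trans ilt _; rewrite lef_pV2 ?posrE ?addr_gt0.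
by rewrite xy ?yz // lt // ?lerDl ?lerDr ltW.
Qed.

HB.instance Definition _ := hasNbhs.Build X (nbhs_ (entourage_ cfg_ball)).
HB.instance Definition _ := @Nbhs_isPseudoMetric.Build R X
  (entourage_ cfg_ball) erefl cfg_ball
  cfg_ball_center cfg_ball_sym cfg_ball_triangle erefl.

Lemma ball_agree x y n : ball x (n.+1%:R^-1 : R) y <-> agree n.+1 x y.
Proof.
rewrite /ball /=; split=> [[_ xy] i ilt|xy].
  by apply: xy; rewrite invrK ltr_nat.
by split=> [|i]; rewrite ?invr_gt0 // invrK ltr_nat; exact: xy.
Qed.

Lemma agree_ball (e : R) : 0 < e ->
  exists n, forall x y, agree n x y -> ball x e y.
Proof.
move=> e0; exists (Num.truncn e^-1).+1 => x y xy; split=> // i ilt.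
apply: xy; rewrite -(ltr_nat R); apply: lt_trans ilt _.
by rewrite truncnS_gt.
Qed.

Lemma open_agreeP (U : set X) :
  open U <-> forall x, U x -> exists n, forall y, agree n x y -> U y.
Proof.
rewrite openE; split=> [oU x /oU|oU x /oU[n xU]].
  move/nbhs_ballP => [e /= /agree_ball[n nP] xU]; exists n => y xy.
  exact/xU/nP.
apply/nbhs_ballP; exists (n.+1%:R^-1) => /=; first by rewrite invr_gt0.
by move=> y /ball_agree xy; apply: xU => i /leqW; exact: xy.
Qed.

Let cfg_complete (F : set_system X) : ProperFilter F -> cauchy F -> cvg F.
Proof.
move=> FF /cauchyP Fc.
have /choice[u Fu] n : exists x, F (agree n.+1 x).
  have [|x xF] := Fc (n.+1%:R^-1); first by rewrite invr_gt0.
  by exists x; apply: filterS xF => y /ball_agree.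
(* Diagonal limit: each coordinate comes from an approximation that already fixes it. Two
   approximations are compared through a common point [w] of their neighbourhoods. *)
pose y : X := fun i => u (pos_of_int i) i.
suff Fy : F --> y by exact: cvgP Fy.
apply/fcvg_ballP => e /agree_ball[n nP].
apply: filterS (Fu n) => z unz; apply: nP => i ilt.
have [w [unw uiw]] := filter_ex (filterI (Fu n) (Fu i)).
rewrite /y int_of_posK uiw // -unw ?unz // ltnS; exact: ltnW.
Qed.

HB.instance Definition _ := Uniform_isComplete.Build X cfg_complete.

Lemma cfg_hausdorff : hausdorff_space X.
Proof.
move=> x y xy; apply/funext => i.
pose e : R := (pos_of_int i).+1%:R^-1; have e0 : 0 < e by rewrite invr_gt0.
have [z [/ball_agree xz /ball_agree yz]] :=
  xy _ _ (nbhsx_ballx x _ e0) (nbhsx_ballx y _ e0).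
by rewrite -[i]pos_of_intK xz // yz.
Qed.

Lemma open_cylinder s : open (cylinder s : set X).
Proof.
apply/open_agreeP => x xs; exists (size s) => y /initialP xy.
  exact: etrans (esym xy) xs.
Qed.

Lemma cfg_dense : exists2 D : set X, countable D & dense D.
Proof.
exists (range (fun s => extend s : X)).
  exact: sub_countable (card_image_le _ _) (countableP _).
move=> U [x Ux] /open_agreeP oU; have [n nP] := oU _ Ux.
exists (extend (initial n x)); split; last by exists (initial n x).
by apply: nP; apply/initialP; rewrite -{2}(size_initial n x) initial_extend.
Qed.

(** An open set is the union of the cylinders it contains, and there are only countably many
    words. *)
Lemma sigma_open_cylinders : <<s @open X >> = <<s @cylinders k >>.
Proof.
apply/seteqP; split; apply: smallest_sub; try exact: smallest_sigma_algebra.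
  move=> U /open_agreeP oU.
  (* An index that codes no word yields the whole space, which is kept only if it lies in [U]. *)
  pose F n : set X := cylinder (odflt ([::] : seq 'Z_k) (unpickle n)).
  have -> : U = \bigcup_n if `[< F n `<=` U >] then F n else set0.
    apply/seteqP; split=> [x Ux|x [n _]]; last by case: asboolP => // + xs; exact.
    have [n nP] := oU _ Ux; exists (pickle (initial n x)); first by [].
    rewrite /F pickleK; case: asboolP => [_|[]]; first exact/cylinder_initial.
    by move=> y /cylinder_initial /nP.
  apply: sigma_algebra_bigcup => n; case: ifP => _; last exact: sigma_algebra0.
  by apply: sub_sigma_algebra; left; eexists.
move=> _ [[s _ <-]|->]; last exact: sigma_algebra0.
by apply: sub_sigma_algebra; exact: open_cylinder.
Qed.

End Topology.

(** * The Bernoulli measure *)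

Section Digits.
Variables (R : realType) (k : nat).
(** The cardinality of ['Z_k], equal to [k] once [1 < k]. *)
Local Notation K := (Zp_trunc k).+2.
Implicit Types (r : R) (s : seq 'Z_k).

(** The base-[K] digit of [r] at place [n] after the point, counted from 0; [inZp] reduces modulo
    [K]. *)
Definition digit n r : 'Z_k := inZp (Num.truncn (r * K%:R ^+ n.+1)).

(** Most significant digit first, as in an expansion after the point. *)
Definition digits_val s : nat := foldl (fun m (d : 'Z_k) => m * K + d)%N 0%N s.

Lemma digits_val_rcons s d : digits_val (rcons s d) = (digits_val s * K + d)%N.
Proof. by rewrite /digits_val foldl_rcons. Qed.

Lemma digits_val_lt s : (digits_val s < K ^ size s)%N.
Proof.
elim/last_ind: s => [//|s d IHs]; rewrite digits_val_rcons size_rcons expnSr.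
apply: (@leq_trans (digits_val s * K + K)%N); first by rewrite ltn_add2l.
by rewrite -mulSnr leq_mul2r IHs orbT.
Qed.

Lemma digits_val_inj s t : size s = size t -> digits_val s = digits_val t -> s = t.
Proof.
elim/last_ind: s t => [|s d IHs] t; first by move=> /esym/size0nil ->.
case/lastP: t => [|t e]; first by rewrite size_rcons.
rewrite !size_rcons !digits_val_rcons => -[sz] E.
have lt (c : 'Z_k) : (c < K)%N by [].
have [/IHs -> // /val_inj -> //] : digits_val s = digits_val t /\ d = e :> nat.
have := congr1 (fun m => m %/ K)%N E; have := congr1 (fun m => m %% K)%N E.
by rewrite !modnMDl !divnMDl // !divn_small // !modn_small // !addn0.
Qed.

Lemma truncn_mulD r n : 0 <= r -> (Num.truncn (r * n.+1%:R) %/ n.+1)%N = Num.truncn r.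
Proof.
move=> r0; set m := Num.truncn _; apply/esym/truncn_def.
have /truncn_itv : 0 <= r * n.+1%:R by rewrite mulr_ge0.
rewrite -/m => /andP[mr rm]; have n0 : 0 < n.+1%:R :> R by [].
rewrite -(ler_pM2r n0) -[X in _ && X](ltr_pM2r n0) -!natrM; apply/andP; split.
  by apply: le_trans mr; rewrite ler_nat leq_divM.
by apply: lt_le_trans rm _; rewrite ler_nat ltn_ceil.
Qed.

(** Dividing the truncation of r K^(n+1) by [K] leaves that of r K^n as quotient and the next digit
    as remainder. *)
Lemma truncn_digits r n : 0 <= r < 1 ->
  Num.truncn (r * K%:R ^+ n) = digits_val (mkseq (digit ^~ r) n).
Proof.
move=> /andP[r0 r1]; elim: n => [|n IHn].
  by rewrite expr0 mulr1; apply: truncn_def; rewrite r0.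
rewrite mkseqS digits_val_rcons -IHn.
rewrite {1}(divn_eq (Num.truncn _) K); congr (_ * _ + _)%N.
by rewrite exprSr mulrA truncn_mulD // mulr_ge0 // exprn_ge0.
Qed.

(** The numbers of [0, 1) whose base-[K] expansion starts with [s]. *)
Definition base_itv s : interval R :=
  `[(digits_val s)%:R / K%:R ^+ size s, (digits_val s).+1%:R / K%:R ^+ size s[.

Let KX_gt0 n : 0 < K%:R ^+ n :> R.
Proof. by rewrite exprn_gt0. Qed.

Lemma base_itv_sub s : [set` base_itv s] `<=` `[0, 1[.
Proof.
move=> r /=; rewrite !in_itv /= => /andP[lr rl]; apply/andP; split.
  by apply: le_trans lr; rewrite divr_ge0 // ltW.
apply: lt_le_trans rl _; rewrite ler_pdivrMr // mul1r -natrX ler_nat.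
exact: digits_val_lt.
Qed.

Lemma digits_base_itv s r : `[0, 1[%classic r ->
  mkseq (digit ^~ r) (size s) = s <-> [set` base_itv s] r.
Proof.
rewrite /= in_itv /= => /[dup] r01 /andP[r0 _].
rewrite in_itv /= ler_pdivrMr // ltr_pdivlMr // -truncn_eq ?mulr_ge0 ?(ltW (KX_gt0 _)) //.
rewrite truncn_digits //; split=> [->//|/eqP E].
by apply: digits_val_inj E; rewrite size_mkseq.
Qed.

Lemma lebesgue_base_itv s :
  lebesgue_measure [set` base_itv s] = (K%:R ^- size s)%:E :> \bar R.
Proof.
rewrite lebesgue_measure_itv /= lte_fin ltr_pM2r ?invr_gt0 // ltr_nat leqnn.
by rewrite -EFinB -mulrBl -natr1 addrAC subrr add0r mul1r.
Qed.

Definition unif01 : set (measurableTypeR R) -> \bar R :=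
  mrestr lebesgue_measure (measurable_itv `[0, 1[%O).

HB.instance Definition _ := Measure.on unif01.

Let unif01_setT : unif01 setT = 1%E.
Proof. by rewrite /unif01 /mrestr setTI lebesgue_measure_itv /= lte01 sube0. Qed.

HB.instance Definition _ :=
  @Measure_isProbability.Build _ _ R unif01 unif01_setT.

End Digits.

Definition cfgB (R : realType) (k : nat) := g_sigma_algebraType (@open (cfg R k)).

HB.instance Definition _ R k := Measurable.on (cfgB R k).

Section Bernoulli.
Variables (R : realType) (k : nat).
Local Notation K := (Zp_trunc k).+2.
Local Notation X := (cfgB R k).
Implicit Types (x y : int -> 'Z_k) (s : seq 'Z_k).

Lemma measurable_cfgE : @measurable _ X = <<s @cylinders k >>.
Proof. by rewrite -sigma_open_cylinders. Qed.

Lemma open_measurable_cfg (U : set X) : open (U : set (cfg R k)) -> measurable (U : set X).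
Proof. by move=> oU; apply: sub_sigma_algebra. Qed.

Lemma measurable_cylinder s : measurable (cylinder s : set X).
Proof. by apply: open_measurable_cfg; exact: open_cylinder. Qed.

(** The hypothesis is uniform continuity, so preimages of open sets are open. *)
Lemma measurable_fun_agree (T : X -> X) :
  (forall n, exists m, forall x y, agree m x y -> agree n (T x) (T y)) ->
  measurable_fun setT T.
Proof.
move=> TP; apply: (@measurability _ _ X X setT T (@open (cfg R k))) => //.
move=> _ [U oU <-]; rewrite setTI; apply: open_measurable_cfg.
apply/open_agreeP => x; move/open_agreeP: oU => /[apply] -[n nP].
by have [m mP] := TP n; exists m => y /mP /nP.
Qed.

(** The base-[K] expansion, spread over the integers by the enumeration; outside [0, 1), which is
    null for [unif01], the value is a dummy. *)
Definition digit_cfg (r : measurableTypeR R) : X := if 0 <= r < 1 then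
  (fun i => digit k (pos_of_int i) r) else (fun=> 0).

Lemma digit_cfg_cylinder s :
  `[0, 1[ `&` digit_cfg @^-1` cylinder s = [set` base_itv R s].
Proof.
have E r : `[0, 1[%classic r -> initial (size s) (digit_cfg r) = mkseq (digit k ^~ r) (size s).
  rewrite /= in_itv /= /digit_cfg => ->.
  by apply: eq_mkseq => i; rewrite int_of_posK.
apply/seteqP; split=> [r [r01 sr]|r sr].
  by apply/digits_base_itv => //; rewrite -E.
have r01 := base_itv_sub sr; split=> //.
by rewrite /preimage /cylinder /= E //; exact/digits_base_itv.
Qed.

Lemma measurable_digit_cfg : measurable_fun setT digit_cfg.
Proof.
apply: (@measurability _ _ _ X setT digit_cfg (@cylinders k)); first exact: measurable_cfgE.
move=> _ [_ [[s _ <-]|->] <-]; last by rewrite preimage_set0 setI0.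
rewrite setTI -[X in measurable X](setUIDK _ `[0, 1[%classic) setIC digit_cfg_cylinder.
apply: measurableU; first exact: measurable_itv.
(* Outside [0, 1) the map is constantly zero, so the preimage contains all of this complement or
   none of it. *)
have [s0|s0] := pselect (cylinder s (fun=> 0 : 'Z_k)).
  rewrite (_ : _ `\` _ = ~` `[0, 1[%classic); first by apply: measurableC; exact: measurable_itv.
  apply/seteqP; split=> [r []//|r] /= rN; split=> //.
  by move: rN; rewrite /= in_itv /= /digit_cfg => /negP/negbTE ->.
rewrite (_ : _ `\` _ = set0) //; apply/seteqP; split=> // r [rs] /= rN; apply: s0.
by move: rs rN; rewrite /preimage /= /digit_cfg in_itv /=; case: ifP.
Qed.

HB.instance Definition _ :=
  isMeasurableFun.Build _ _ _ _ digit_cfg measurable_digit_cfg.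

(** The uniform product measure, obtained as the law of the digits of a uniform random number. *)
Definition bernoulli_cfg : probability X R := distribution (@unif01 R) digit_cfg.

Lemma bernoulli_cylinder s : bernoulli_cfg (cylinder s) = (K%:R ^- size s)%:E.
Proof.
rewrite /bernoulli_cfg /= /distribution /pushforward /= /unif01 /mrestr setIC.
by rewrite digit_cfg_cylinder lebesgue_base_itv.
Qed.

(** Cylinders form a generating pi-system, and [cylinder [::]] is the whole space. *)
Lemma cfg_measure_unique (m1 m2 : probability X R) :
  (forall s, m1 (cylinder s) = m2 (cylinder s)) ->
  forall A, measurable A -> m1 A = m2 A.
Proof.
move=> m12 A mA; apply: (@measure_unique _ _ X (@cylinders k) (fun=> cylinder [::])) => //.
- exact: measurable_cfgE.
- exact: cylinders_setI.
- by move=> _; left; exists [::].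
- by apply/seteqP; split=> // x _; exists 0%N.
- by move=> _ [[s _ <-]|->]; [exact: m12|rewrite !measure0].
- by move=> _; rewrite (le_lt_trans (probability_le1 _ _)) ?ltry //; exact: measurable_cylinder.
Qed.

End Bernoulli.

(** * Invariance of the Bernoulli measure under translations and shifts *)

Section Invariance.
Variables (R : realType) (k : nat).
Local Notation K := (Zp_trunc k).+2.
Local Notation X := (cfgB R k).
Implicit Types (x y f w : int -> 'Z_k) (s : seq 'Z_k) (I : seq int).

Definition translate f x : int -> 'Z_k := fun i => f i + x i.

Definition shift (n : int) x : int -> 'Z_k := fun i => x (i - n).

Lemma shiftNK n x i : shift (- n) x (i - n) = x i.
Proof. by rewrite /shift; congr x; rewrite opprK subrK. Qed.

Lemma agree_translate f n x y : agree n x y -> agree n (translate f x) (translate f y).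
Proof. by move=> xy i /xy E; rewrite /translate E. Qed.

Lemma measurable_translate f : measurable_fun setT (translate f : X -> X).
Proof. by apply: measurable_fun_agree => n; exists n; exact: agree_translate. Qed.

Lemma measurable_shift n : measurable_fun setT (shift n : X -> X).
Proof.
apply: measurable_fun_agree => m.
exists (\max_(j < m) pos_of_int (int_of_pos j - n)).+1 => x y xy i im.
rewrite /shift -[int_of_pos i - n]pos_of_intK; apply: xy; rewrite ltnS.
exact: (leq_bigmax (Ordinal im)).
Qed.

Definition preserves (m : probability X R) (T : X -> X) :=
  forall A, measurable A -> m (T @^-1` A) = m A.

Lemma preserves_cylinder (m : probability X R) (T : X -> X) :
  measurable_fun setT T ->
  (forall s, m (T @^-1` cylinder s) = m (cylinder s)) -> preserves m T.
Proof.
move=> mT mTs A mA.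
pose f := HB.pack_for {mfun X >-> X} T (isMeasurableFun.Build _ _ _ _ T mT).
exact: (@cfg_measure_unique _ _ (distribution m f) m).
Qed.

Lemma translate_cylinder f s : exists2 t,
  translate f @^-1` cylinder s = cylinder t & size t = size s.
Proof.
pose t := initial (size s) (translate (- f) (extend s)).
exists t; last by rewrite size_initial.
rewrite -{1}[s]initial_extend; apply/seteqP; split=> x /=.
  move=> /cylinder_initial E; apply/cylinder_initial => i ilt.
  by rewrite /translate (E i ilt) /translate addKr.
move=> /cylinder_initial E; apply/cylinder_initial => i ilt.
by rewrite /translate -(E i ilt) /translate addrA subrr add0r.
Qed.

Lemma bernoulli_translate f : preserves (bernoulli_cfg R k) (translate f).
Proof.
apply: preserves_cylinder => [|s]; first exact: measurable_translate.
have [t -> st] := translate_cylinder f s.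
by rewrite !bernoulli_cylinder st.
Qed.

(** Prescribes digits at arbitrary places: unlike the sets [cylinder s], this family is stable under
    shifts. *)
Definition fin_cylinder I w : set X := [set x | forall i, i \in I -> x i = w i].

Lemma open_measurable_agree (U : set X) :
  (forall x, U x -> exists n, forall y, agree n x y -> U y) -> measurable U.
Proof. by move=> UP; apply: open_measurable_cfg; exact/open_agreeP. Qed.

Lemma measurable_window (U : set X) I :
  (forall x y, (forall i, i \in I -> x i = y i) -> U x -> U y) -> measurable U.
Proof.
move=> UP; apply: open_measurable_agree => x Ux.
exists (\max_(i <- I) pos_of_int i).+1 => y xy; apply: UP Ux => i iI.
rewrite -[i]pos_of_intK; apply: xy; rewrite ltnS.
exact: (@leq_bigmax_seq _ _ predT).
Qed.

Lemma measurable_fin_cylinder I w : measurable (fin_cylinder I w).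
Proof.
by apply: (@measurable_window _ I) => x y xy xw i iI; rewrite -xy // xw.
Qed.

(* Translating one coordinate permutes the [K] cylinders into which
   a cylinder splits when that coordinate is prescribed. *)
Lemma translation_invariant_fin_cylinder (m : probability X R) :
  (forall f, preserves m (translate f)) ->
  forall I w, uniq I -> m (fin_cylinder I w) = (K%:R ^- size I)%:E.
Proof.
move=> mT I w; elim: I => [_|i I IHI /= /andP[iI /IHI mI]].
  by rewrite expr0 invr1 -[RHS](probability_setT m); congr (m _); apply/seteqP; split.
pose u (c : 'Z_k) j : 'Z_k := if j == i then c else w j.
have mu c : m (fin_cylinder (i :: I) (u c)) = m (fin_cylinder (i :: I) w).
  pose f j : 'Z_k := if j == i then w i - c else 0.
  rewrite -(mT f (fin_cylinder (i :: I) w)); last exact: measurable_fin_cylinder.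
  congr (m _); apply/seteqP; split=> x xw j jI; have := xw j jI;
    rewrite /translate /u /f; case: eqVneq => [->|_] //.
  - by move=> ->; rewrite subrK.
  - by rewrite add0r.
  - by move=> E; apply: (addrI (w i - c)); rewrite E subrK.
  - by rewrite add0r.
have splitI : fin_cylinder I w = \big[setU/set0]_(c < K) fin_cylinder (i :: I) (u c).
  rewrite -bigcup_seq; apply/seteqP; split=> x.
    move=> xw; exists (x i); first by rewrite /= mem_index_enum.
    move=> j; rewrite inE /u; case: eqVneq => [->//|_] /=.
    exact: xw.
  move=> [c _ xw] j jI; rewrite xw ?inE ?jI ?orbT // /u; case: eqVneq => // ji.
  by rewrite -ji jI in iI.
move: mI; rewrite splitI measure_bigsetU_ord; last 2 first.
- by move=> c; exact: measurable_fin_cylinder.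
- move=> c d _ _ [x [xc xd]]; have := xc i; rewrite xd ?mem_head // /u eqxx.
  by move=> ->.
rewrite (eq_bigr (fun=> m (fin_cylinder (i :: I) w))); last by move=> c _; exact: mu.
move=> E.
have mfin : m (fin_cylinder (i :: I) w) \is a fin_num.
  by apply: fin_num_measure; exact: measurable_fin_cylinder.
rewrite -(fineK mfin) sumEFin in E *; congr (_%:E); case: E => E.
by rewrite exprS invfM -E sumr_const card_ord -[fine _ *+ _]mulr_natl mulKf.
Qed.

Lemma bernoulli_fin_cylinder I w : uniq I ->
  bernoulli_cfg R k (fin_cylinder I w) = (K%:R ^- size I)%:E.
Proof. exact/translation_invariant_fin_cylinder/bernoulli_translate. Qed.

Lemma cylinder_fin_cylinder s :
  cylinder s = fin_cylinder (map int_of_pos (iota 0 (size s))) (extend s).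
Proof.
rewrite -{1}[s]initial_extend; apply/seteqP; split=> x.
  by move=> /cylinder_initial E i /mapP[j + ->]; rewrite mem_iota => /E ->.
move=> E; apply/cylinder_initial => i ilt; rewrite E //.
by apply: map_f; rewrite mem_iota.
Qed.

(** The preimage of a cylinder prescribes equally many digits at moved places, and the measure
    depends only on their number. *)
Lemma bernoulli_shift n : preserves (bernoulli_cfg R k) (shift n).
Proof.
apply: preserves_cylinder => [|s]; first exact: measurable_shift.
rewrite bernoulli_cylinder cylinder_fin_cylinder.
set I := map _ _; have -> : shift n @^-1` fin_cylinder I (extend s) =
    fin_cylinder (map (fun i => i - n) I) (shift (- n) (extend s)).
  apply/seteqP; split=> x xs i.
    by move=> /mapP[j jI ->]; rewrite shiftNK -(xs _ jI).
  by move=> iI; rewrite -[RHS](shiftNK n) -xs ?(map_f (fun j => j - n)).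
rewrite bernoulli_fin_cylinder ?size_map ?size_iota // map_inj_uniq; last exact: addIr.
by rewrite map_inj_uniq ?iota_uniq //; exact: can_inj int_of_posK.
Qed.

End Invariance.

(** * Adding elements of Z[1/k] with carries *)

Section Windows.
Variable k : nat.
Local Notation K := (Zp_trunc k).+2.
Implicit Types (x y z : int -> 'Z_k) (a n i : int) (l : nat) (p q : rat).

(** Least significant digit first: place [a] has weight 1 here, and its true weight K^a is restored
    in [wval]. *)
Definition window a l x : nat := \sum_(i < l) ((x (a + i%:Z)%R : nat) * K ^ i)%N.

Lemma windowD a l m x :
  window a (l + m) x = (window a l x + K ^ l * window (a + l%:Z) m x)%N.
Proof.
rewrite /window big_split_ord /= big_distrr /=; congr addn; apply: eq_bigr => i _.
by rewrite PoszD addrA expnD mulnCA.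
Qed.

Lemma window1 a x : window a 1 x = x a.
Proof. by rewrite /window big_ord1 addr0 muln1. Qed.

Lemma eq_window a l x y :
  (forall i : nat, (i < l)%N -> x (a + i%:Z) = y (a + i%:Z)) -> window a l x = window a l y.
Proof. by move=> xy; apply: eq_bigr => i _; rewrite xy. Qed.

(** Digitwise complementation turns the value into the room left above it, which reduces carrying to
    borrowing. *)
Lemma window_compl a l x :
  (window a l x + window a l (fun i => rev_ord (x i))).+1%N = (K ^ l)%N.
Proof.
rewrite /window -big_split /= (eq_bigr (fun i : 'I_l => K.-1 * K ^ i)%N) => [|i _].
  by rewrite -[RHS]prednK ?expn_gt0 // predn_exp big_distrr.
rewrite -mulnDl; congr muln; have := ltn_ord (x (a + i%:Z)); lia.
Qed.

Lemma window_ge a l x (i : nat) : (i < l)%N -> ((x (a + i%:Z)%R : nat) * K ^ i <= window a l x)%N.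
Proof. by move=> il; rewrite /window (bigD1 (Ordinal il)) //= leq_addr. Qed.

Lemma window_inj a l x y : window a l x = window a l y ->
  forall i : nat, (i < l)%N -> x (a + i%:Z) = y (a + i%:Z).
Proof.
elim: l a => [//|l IHl] a; rewrite -add1n !windowD !window1 expn1 => E.
have lt (c : 'Z_k) : (c < K)%N by [].
have [xy0 /IHl xy] : x a = y a :> nat /\
    window (a + 1%:Z) l x = window (a + 1%:Z) l y.
  have := congr1 (fun m => m %/ K)%N E; have := congr1 (fun m => m %% K)%N E.
  rewrite ![(_ + K * _)%N]addnC ![(K * _)%N]mulnC !modnMDl !divnMDl //.
  by rewrite !divn_small // !modn_small // !addn0.
case=> [|i] il; first by rewrite addr0; apply: val_inj.
by rewrite -[i.+1]add1n PoszD addrA xy.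
Qed.

Lemma sum_digits (v l : nat) :
  (\sum_(i < l) v %/ K ^ i %% K * K ^ i = v %% K ^ l)%N.
Proof.
elim: l => [|l IHl]; first by rewrite big_ord0 modn1.
rewrite big_ord_recr /= IHl modn_divl -expnS addnC.
rewrite [RHS](divn_eq _ (K ^ l)); congr addn.
by rewrite modn_dvdm // expnS dvdn_mull.
Qed.

Definition wval a l x : rat := (window a l x)%:R * K%:R ^ a.

Let K0 : K%:R != 0 :> rat. Proof. by rewrite pnatr_eq0. Qed.

(* That is, the finite sum of the [(y i - x i) k ^ i] is [q]. *)
Definition displaced q x y := exists n : nat,
  (forall i, (n <= `|i|)%N -> x i = y i) /\
  forall a l, a <= - n%:Z -> n%:Z <= a + l%:Z -> wval a l y - wval a l x = q.

Lemma displaced0 x : displaced 0 x x.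
Proof. by exists 0%N; split=> // a l _ _; rewrite subrr. Qed.

Lemma displacedD p q x y z :
  displaced p y z -> displaced q x y -> displaced (p + q) x z.
Proof.
move=> [m [yz mP]] [n [xy nP]]; exists (m + n)%N; split=> [i le|a l le1 le2].
  by rewrite xy ?yz //; apply: leq_trans le; rewrite ?leq_addl ?leq_addr.
by rewrite -(mP a l) ?(nP a l) -?(nP a l); lia || rewrite addrA subrK.
Qed.

Lemma displacedN q x y : displaced q x y -> displaced (- q) y x.
Proof.
move=> [n [xy nP]]; exists n; split=> [i /xy //|a l le1 le2].
by rewrite -(nP a l) // opprB.
Qed.

Lemma displaced_fun p q x y : displaced p x y -> displaced q x y -> p = q.
Proof.
move=> [m [_ mP]] [n [_ nP]].
by rewrite -(mP (- (m + n)%:Z) (m + n).*2) ?(nP (- (m + n)%:Z)) //; lia.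
Qed.

(** The displacement from [y] to [z] is 0, so they have equal values on a window large enough to
    contain any given place, and base-[K] digits are unique. *)
Lemma displaced_inj q x y z : displaced q x y -> displaced q x z -> y = z.
Proof.
move=> /displacedN xy /displacedD/(_ xy); rewrite addrN => -[n [_ nP]].
apply/funext => i; pose a := - (n + `|i|)%:Z.
have /eqP := nP a (n + `|i|).*2.+1 ltac:(lia) ltac:(lia).
rewrite subr_eq0 (inj_eq (mulIf _)) ?expfz_neq0 // eqr_nat => /eqP/window_inj.
move=> /(_ `|i - a|%N ltac:(lia)); rewrite (_ : a + _ = i) //; lia.
Qed.

(** A larger window splits into three, and the two outer parts contribute equally to [x] and [y]. *)
Lemma displaced_window a l x y :
  (forall i, ~~ (a <= i < a + l%:Z) -> x i = y i) ->
  displaced (wval a l y - wval a l x) x y.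
Proof.
move=> xy; exists (`|a| + l)%N; split=> [i le|b m le1 le2]; first by apply: xy; lia.
have -> : m = (`|(a - b : int)| + l + `|(b + m%:Z - a - l%:Z : int)|)%N by lia.
rewrite /wval !windowD; set u := `|(a - b : int)|%N; set v := `|(_ : int)|%N.
rewrite (_ : b + u%:Z = a); last by rewrite /u; lia.
rewrite (@eq_window b u x y); last by move=> i iu; apply: xy; lia.
rewrite (@eq_window (b + (u + l)%N%:Z) v x y); last by move=> i iu; apply: xy; lia.
rewrite (_ : a = u%:Z + b); last by rewrite /u; lia.
rewrite expfzDr // -exprnP !natrD !natrM natrX.
ring.
Qed.

Lemma wval_shift a l n x : wval a l (shift n x) = K%:R ^ n * wval (a - n) l x.
Proof.
rewrite /wval mulrCA -expfzDr // (_ : n + _ = a); last by rewrite addrC subrK.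
congr (_%:R * _).
by apply: eq_bigr => i _; rewrite /shift addrAC.
Qed.

(** Shifting multiplies all weights by K^n: this is the action of the generator [t] on Z[1/k]. *)
Lemma displaced_shift n q x y :
  displaced q x y -> displaced (K%:R ^ n * q) (shift n x) (shift n y).
Proof.
move=> [m [xy mP]]; exists (m + `|n|)%N; split=> [i le|a l le1 le2].
  by apply: xy; lia.
by rewrite !wval_shift -mulrBr mP //; lia.
Qed.

End Windows.

(** * The odometer and the action of BS(1, k) *)

Section Odometer.
Variable k : nat.
Local Notation K := (Zp_trunc k).+2.
Implicit Types (x y z : int -> 'Z_k) (p q : rat).

(* A nonzero digit and a digit other than [K - 1] at places at least [b - j]
   absorb the borrow or the carry, so that the sum fits into the window. *)
Lemma displaced_ex (j b s i1 i2 : nat) (m : int) x :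
  (`|m| < K ^ b)%N -> (i1 < s)%N -> (i2 < s)%N ->
  x (b%:Z - j%:Z + i1%:Z) <> ord0 -> x (b%:Z - j%:Z + i2%:Z) <> ord_max ->
  exists y, (forall i : int, ~~ (- j%:Z <= i < - j%:Z + (b + s)%N%:Z) -> x i = y i) /\
    displaced (m%:~R / K%:R ^+ j) x y.
Proof.
move=> mb i1s i2s xi1 xi2; pose a := - j%:Z; pose l := (b + s)%N.
(* A nonzero digit at index at least [b] of the window makes its value at least K^b, hence larger
   than the absolute value of [m]. Used for [x] it leaves room to subtract, for its complement room
   to add. *)
have ge w (i : nat) : (i < s)%N -> w (b%:Z - j%:Z + i%:Z) <> ord0 :> 'Z_k ->
    (K ^ b <= window a l w)%N.
  move=> lt_is wi; apply: leq_trans (window_ge a w (_ : b + i < l)%N); last by rewrite ltn_add2l.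
  rewrite (_ : a + _ = b%:Z - j%:Z + i%:Z); last by rewrite /a; lia.
  rewrite expnD mulnCA leq_pmulr // muln_gt0 expn_gt0 andbT lt0n.
  by apply: contra_not_neq wi => E; exact: val_inj.
have lo := ge x i1 i1s xi1.
have {ge} := ge (fun i => rev_ord (x i)) i2 i2s.
have /[swap] /[apply] : rev_ord (x (b%:Z - j%:Z + i2%:Z)) <> ord0.
  move=> E; apply: xi2; apply: rev_ord_inj; rewrite E; apply: val_inj => /=.
  by rewrite subnn.
have := window_compl a l x => E hi.
pose v := `|((window a l x)%:Z + m : int)|%N.
have aux (w w' u u' : nat) : (`|m| < u)%N -> (u <= w)%N -> (u <= w')%N ->
    (w + w').+1%N = u' ->
    `|(w%:Z + m : int)|%N%:Z = w%:Z + m /\ (`|(w%:Z + m : int)| < u')%N by lia.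
have [vE vlt] : v%:Z = (window a l x)%:Z + m /\ (v < K ^ l)%N := aux _ _ _ _ mb lo hi E.
(* The window is overwritten with the base-[K] digits of its new value [v]. *)
pose y i : 'Z_k := if a <= i < a + l%:Z then inZp (v %/ K ^ `|(i - a : int)|%N) else x i.
have xy i : ~~ (a <= i < a + l%:Z) -> x i = y i by rewrite /y => /negbTE ->.
exists y; split=> //.
have yv : window a l y = v.
  rewrite -[RHS](modn_small vlt) -sum_digits; apply: eq_bigr => i _.
  rewrite /y ifT; last by have := ltn_ord i; lia.
  by rewrite (_ : `|_|%N = i) //; lia.
have := displaced_window xy; rewrite /wval yv -mulrBl.
rewrite (_ : v%:R - _ = m%:~R); last first.
  by rewrite -[_%:R]/(v%:Z%:~R) vE rmorphD /= addrC addKr.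
by rewrite /a -exprnN.
Qed.

(* The step [1] alone makes carries stop; the other steps make both actions
   free. *)
Definition good x := forall (a : int) (n : nat) (c : 'Z_k),
  exists t : nat, x (a + (n.+1 * t)%N%:Z) <> c.

Lemma displaced_good q x y : displaced q x y -> good x -> good y.
Proof.
move=> [m [xy _]] gx a n c.
have [t xt] := gx (a + (n.+1 * (m + `|a|))%N%:Z) n c.
exists (m + `|a| + t)%N; rewrite mulnDr PoszD addrA -xy //; lia.
Qed.

Lemma good_shift n x : good x -> good (shift n x).
Proof.
by move=> gx a m c; have [t xt] := gx (a - n) m c; exists t; rewrite /shift addrAC.
Qed.

(** Carrying is specified by its outcome, which [displaced_inj] makes unique. The default [x] of
    [xget] makes the map the identity on sequences that are not good. *)
Definition odometer q x := xget x [set y | good x /\ displaced q x y].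

Lemma odometer_bad q x : ~ good x -> odometer q x = x.
Proof. by move=> bx; apply: xgetPN => y -[]. Qed.

Lemma odometer_eq q x y : good x -> displaced q x y -> odometer q x = y.
Proof.
move=> gx xy; rewrite /odometer; case: xgetP => [z _ [_ xz]|].
  exact: displaced_inj xz xy.
by move/(_ y)/not_andP => -[].
Qed.

Hypothesis hk : (1 < k)%N.

Lemma odometerP (q : Zinv k) x : good x -> displaced (q : rat) x (odometer q x).
Proof.
move=> gx; have [y xy] : exists y, displaced (q : rat) x y.
  case: q => q /= /asboolP[j /intrP[m qm]].
  (* [0] stands for step 1: digits other than 0 and other than K - 1 are sought among all places
     from b - j on, with b the absolute value of [m], a crude choice satisfying b < K^b. *)
  have [t1 xt1] := gx (`|m|%N%:Z - j%:Z) 0%N ord0.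
  have [t2 xt2] := gx (`|m|%N%:Z - j%:Z) 0%N ord_max.
  rewrite !mul1n in xt1 xt2.
  have mb : (`|m| < K ^ `|m|)%N by exact: ltn_expl.
  have t1s : (t1 < (t1 + t2).+1)%N by rewrite ltnS leq_addr.
  have t2s : (t2 < (t1 + t2).+1)%N by rewrite ltnS leq_addl.
  have [y [_ xy]] := displaced_ex mb t1s t2s xt1 xt2.
  exists y; suff <- : m%:~R / K%:R ^+ j = q by [].
  by rewrite -qm Zp_cast // mulfK // expf_neq0 // pnatr_eq0 -lt0n ltnW.
by rewrite (odometer_eq gx xy).
Qed.

Lemma odometer_good (q : Zinv k) x : good (odometer q x) <-> good x.
Proof.
split=> [|gx]; last exact: displaced_good (odometerP q gx) gx.
by have [//|bx] := pselect (good x); rewrite odometer_bad.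
Qed.

Lemma good_shiftE n x : good (shift n x) <-> good x.
Proof.
split=> [gx|]; last exact: good_shift.
suff -> : x = shift (- n) (shift n x) by exact: good_shift.
by apply/funext => i; rewrite /shift opprK addrK.
Qed.

Lemma shiftD m n x : shift (m + n) x = shift m (shift n x).
Proof. by apply/funext => i; rewrite /shift opprD addrA. Qed.

Lemma shift0 x : shift 0 x = x.
Proof. by apply/funext => i; rewrite /shift subr0. Qed.

Definition BS_action (g : BS1 hk) x : int -> 'Z_k :=
  odometer (g.1 : rat) (shift g.2 x).

Lemma BS_action1 x : BS_action 1%g x = x.
Proof.
rewrite /BS_action shift0; have [gx|bx] := pselect (good x).
  by apply: odometer_eq => //; exact: displaced0.
exact: odometer_bad.
Qed.

(** On good sequences displacements add after [p] is scaled by k^m, which is the group law. On the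
    others, a shift-stable set, only the shifts act, so the identity holds everywhere. *)
Lemma BS_actionM g h x : BS_action (g * h)%g x = BS_action g (BS_action h x).
Proof.
case: g h => [q m] [p n]; rewrite /BS_action /= -/(shift n x) shiftD.
have [gx|bx] := pselect (good (shift n x)); last first.
  by rewrite [odometer p _]odometer_bad // !odometer_bad // good_shiftE.
apply: odometer_eq; first exact: good_shift.
have E : k%:R = K%:R :> rat by rewrite Zp_cast.
rewrite /= E.

apply: displacedD (displaced_shift m (odometerP p gx)).
by apply: odometerP; apply: good_shift; apply/odometer_good.
Qed.

End Odometer.

(** * The two actions *)

Section Lamps.
Variable k : nat.
Local Notation K := (Zp_trunc k).+2.
Implicit Types (x y z : int -> 'Z_k) (f : lamps k).

Lemma finsupp_boundP (f : int -> 'Z_k) :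
  f \in @finsupp_pred k <-> exists n : nat, forall i : int, (n <= `|i|)%N -> f i = 0.
Proof.
split=> [/asboolP/finite_seqP[s sE]|[n fn]].
  exists (\max_(i <- s) `|i|).+1 => i ilt; apply/eqP/negPn/negP => fi.
  have /= is_ : [set` s] i by rewrite -sE.
  by move: ilt; rewrite ltnNge (@leq_bigmax_seq _ s predT (fun i : int => `|i|%N)).
apply/asboolP; apply: (@sub_finite_set _ _ (int_of_pos @` `I_n.*2)).
  move=> i /= fi; exists (pos_of_int i); last exact: pos_of_intK.
  have : (`|i| < n)%N by rewrite ltnNge; apply: contra_neqN fi; exact: fn.
  case: i {fi} => i /=; lia.
exact: finite_image.
Qed.

Lemma lamps_bound f : exists n : nat, forall i : int, (n <= `|i|)%N -> f i = 0.
Proof. by apply/finsupp_boundP; case: f. Qed.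

Lemma lamps_diff x y : (exists n : nat, forall i : int, (n <= `|i|)%N -> x i = y i) ->
  exists f, translate f x = y.
Proof.
move=> [n xy]; have /finsupp_boundP fP : exists n : nat,
    forall i : int, (n <= `|i|)%N -> y i - x i = 0.
  by exists n => i /xy ->; rewrite subrr.
by exists (Lamps fP); apply/funext => i; rewrite /translate /= subrK.
Qed.

Lemma translate_tail f x : exists n : nat,
  forall i : int, (n <= `|i|)%N -> x i = translate f x i.
Proof.
by have [n fn] := lamps_bound f; exists n => i /fn fi; rewrite /translate fi add0r.
Qed.

Lemma translate_inj f (g : lamps k) x : translate f x = translate g x -> f = g.
Proof.
move=> fg; apply/val_inj/funext => i /=.
by have := congr1 (fun y => y i) fg; rewrite /translate => /addIr.
Qed.

Lemma translateK f : cancel (translate f) (translate (- f)).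
Proof. by move=> x; apply/funext => i; rewrite /translate /= addKr. Qed.

(** A configuration is determined by a radius bounding its support and its values within that
    radius. *)
Lemma countable_lamps : exists code : lamps k -> nat, injective code.
Proof.
have /choice[b bP] := lamps_bound.
exists (fun f => pickle (b f, mkseq (fun i => f (i%:Z - (b f)%:Z)) (b f).*2)).
move=> f g /(pcan_inj pickleK)[bfg /eqP]; rewrite bfg => /eqP fg.
apply/val_inj/funext => i /=; have [le|lt] := leqP (b g) `|i|.
  by rewrite !bP // bfg.
pose j := `|(i + (b g)%:Z : int)|%N.
have jlt : (j < (b g).*2)%N by rewrite /j; lia.
have ji : j%:Z - (b g)%:Z = i by rewrite /j; lia.
by have := congr1 (fun s => nth 0 s j) fg; rewrite !nth_mkseq // ji.
Qed.

Definition lamplighter_action (g : lamplighter k) x : int -> 'Z_k :=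
  translate g.1 (shift g.2 x).

Lemma lamplighter_action1 x : lamplighter_action 1%g x = x.
Proof. by apply/funext => i; rewrite /lamplighter_action shift0 /translate /= add0r. Qed.

Lemma lamplighter_actionM g h x :
  lamplighter_action (g * h)%g x = lamplighter_action g (lamplighter_action h x).
Proof.
by apply/funext => i; rewrite /lamplighter_action /= shiftD /translate /shift /= addrA.
Qed.

(** For nonzero [n], the sequence would be constant from place [m] on along a progression with step
    the absolute value of [n]. *)
Lemma good_aperiodic x (n : int) (m : nat) : good x ->
  (forall i : int, m%:Z <= i -> x i = x (i - n)) -> n = 0.
Proof.
move=> gx xn; apply/eqP/negPn/negP => n0.
(* [good] takes the predecessor of the step. *)
have [t] := gx m%:Z (`|n|%N.-1) (x m%:Z); apply.
elim: t => [|t IHt]; first by rewrite muln0 addr0.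
rewrite -{}IHt; case: (lerP 0 n) => [n_ge0|n_lt0].
  by rewrite xn; [congr x; lia|lia].
by rewrite [RHS]xn; [congr x; lia|lia].
Qed.

(** Beyond the support of [f] a fixed point agrees with its shift by [n], so [n] is 0 by
    aperiodicity, and then [f] is 0. *)
Lemma lamplighter_free g x : good x -> lamplighter_action g x = x -> g = 1%g.
Proof.
case: g => [f n] gx; rewrite /lamplighter_action /= => fx.
have [m fm] := translate_tail f (shift n x).
have n0 : n = 0.
  apply: (@good_aperiodic x n m) => // i mi.
  by rewrite -(congr1 (fun y => y i) fx); apply/esym/fm; lia.
move: fx; rewrite n0 shift0 => fx; congr (_, _); apply: (@translate_inj _ _ x).
by rewrite fx; apply/funext => i; rewrite /translate add0r.
Qed.

Variable hk : (1 < k)%N.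

Lemma BS_free (g : BS1 hk) x : good x -> BS_action g x = x -> g = 1%g.
Proof.
case: g => [q n] gx; rewrite /BS_action /= => qx.
have := odometerP hk q (good_shift n gx); rewrite qx => xx.
have n0 : n = 0.
  case: xx => m [xm _]; apply: (@good_aperiodic x n m) => // i mi.
  by apply/esym/xm; lia.
move: xx; rewrite n0 shift0 => /(displaced_fun (displaced0 x)) q0.
by congr (_, _); apply: val_inj.
Qed.

(** No place below -n enters the difference, so its denominator divides k^n. *)
Lemma tail_Zinv x y : (exists n : nat, forall i : int, (n <= `|i|)%N -> x i = y i) ->
  exists q : Zinv k, displaced (q : rat) x y.
Proof.
move=> [n xy].
pose q : rat := wval (- n%:Z) n.*2 y - wval (- n%:Z) n.*2 x.
have qP : q \in Zinv_pred k.
  apply/asboolP; exists n; rewrite /q /wval -mulrBl -exprnN -mulrA Zp_cast //.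
  by rewrite mulVf ?mulr1 ?rpredB ?rpred_nat // expf_neq0 // pnatr_eq0 -lt0n ltnW.
by exists (MkZinv qP); apply: displaced_window => i ilt; apply: xy; lia.
Qed.

(** Both orbits consist of the sequences that differ from some shift of [x] at finitely many
    places. *)
Lemma orbit_eq x : good x ->
  [set lamplighter_action g x | g in setT] = [set BS_action g x | g in [set: BS1 hk]].
Proof.
move=> gx; apply/seteqP; split=> _ [[u n] _ <-].
  have [q qx] := tail_Zinv (translate_tail u (shift n x)).
  exists (q, n) => //; apply: odometer_eq => //; exact: good_shift.
have [m [xm _]] := odometerP hk u (good_shift n gx).
have [f fx] : exists f, translate f (shift n x) = odometer u (shift n x).
  by apply: lamps_diff; exists m.
by exists (f, n).
Qed.

End Lamps.

(** * Good sequences have full measure, and the odometer preserves the measure *)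

Section Coupling.
Variables (R : realType) (k : nat).
Local Notation K := (Zp_trunc k).+2.
Local Notation X := (cfgB R k).
Local Notation mu := (bernoulli_cfg R k).
Implicit Types (x y z : int -> 'Z_k) (f : lamps k).

(** The sequences that are not good form the union of these sets, over a countable set of
    parameters. *)
Definition progression (p : int * nat * 'Z_k) : set X :=
  [set x | forall t : nat, x (p.1.1 + (p.1.2.+1 * t)%N%:Z) = p.2].

Let times a n s : seq int := map (fun t => a + (n.+1 * t)%N%:Z) (iota 0 s).

Let progressionE a n c :
  progression (a, n, c) = \bigcap_s fin_cylinder (times a n s) (fun=> c).
Proof.
apply/seteqP; split=> [x xc s _ i /mapP[t _ ->]|x xc t]; first exact: xc.
by apply: (xc t.+1 I); apply/mapP; exists t; rewrite // mem_iota add0n leqnn.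
Qed.

Lemma measurable_progression p : measurable (progression p).
Proof.
case: p => -[a n] c; rewrite progressionE; apply: bigcap_measurable => //.
by move=> s _; exact: measurable_fin_cylinder.
Qed.

Lemma geometric_lt (e : R) : 0 < e -> exists n : nat, K%:R ^- n < e.
Proof.
move=> e0; exists (Num.truncn e^-1).+1.
rewrite -[ltRHS]invrK ltf_pV2 ?posrE ?invr_gt0 ?exprn_gt0 //.
apply: (lt_trans (truncnS_gt _)); rewrite -natrX ltr_nat.
exact: ltn_expl.
Qed.

(** Prescribing the first [s] digits of the progression already has measure K^(-s), which is
    arbitrarily small. *)
Lemma progression0 p : mu (progression p) = 0%E.
Proof.
apply/eqP; rewrite eq_le measure_ge0 andbT; apply/lee_addgt0Pr => e e0.
rewrite add0e; have [s /ltW se] := geometric_lt e0; case: p => -[a n] c.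
apply: (@le_trans _ _ (mu (fin_cylinder (times a n s) (fun=> c)))).
  apply: le_measure; rewrite ?inE; [exact: measurable_progression|exact: measurable_fin_cylinder|].
  by rewrite progressionE => x; exact.
rewrite bernoulli_fin_cylinder ?size_map ?size_iota ?lee_fin // map_inj_uniq ?iota_uniq //.
by move=> t u /addrI[] /eqP; rewrite eqn_pmul2l // => /eqP.
Qed.

Let prog j : set X := if unpickle j is Some p then progression p else set0.

Let good_bigcap : [set x : X | good x] = ~` \bigcup_j prog j.
Proof.
apply/seteqP; split=> x /= gx.
  move=> [j _]; rewrite /prog; case: unpickle => // -[[a n] c] xc.
  by have [t] := gx a n c; apply; exact: xc.
move=> a n c; apply: contrapT => xc; apply: gx; exists (pickle (a, n, c)); first exact: I.
rewrite /prog pickleK => t; apply: contrapT => xt; apply: xc.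
by exists t.
Qed.

Let measurable_prog j : measurable (prog j).
Proof. by rewrite /prog; case: unpickle => // p; exact: measurable_progression. Qed.

Lemma measurable_good : measurable [set x : X | good x].
Proof. by rewrite good_bigcap; apply: measurableC; exact: bigcupT_measurable. Qed.

Lemma bad_negligible : mu.-negligible (~` [set x : X | good x]).
Proof.
rewrite good_bigcap setCK; apply: negligible_bigcup => j.
apply/negligibleP; first exact: measurable_prog.
by rewrite /prog; case: unpickle => [p|]; [exact: progression0|exact: measure0].
Qed.

Let bad0 : mu (~` [set x : X | good x]) = 0%E.
Proof.
apply/negligibleP; last exact: bad_negligible.
by apply: measurableC; exact: measurable_good.
Qed.

Lemma ae_of_good (P : X -> Prop) : (forall x, good x -> P x) -> \forall x \ae mu, P x.
Proof.
by move=> gP; apply: negligibleS bad_negligible => x /=; apply: contra_not; exact: gP.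
Qed.

Lemma measure_good (A : set X) : measurable A -> mu (A `&` [set x | good x]) = mu A.
Proof.
move=> mA; rewrite [RHS](measureDI _ mA measurable_good).
rewrite [X in (X + _)%E](_ : _ = 0%E) ?add0e //.
apply: (subset_measure0 _ _ _ bad0).
- by apply: measurableD => //; exact: measurable_good.
- by apply: measurableC; exact: measurable_good.
- by rewrite setDE; exact: subIsetr.
Qed.

(** The set of good sequences on which adding [q] is translation by [f]. *)
Definition piece (q : rat) f : set X := [set x | good x /\ displaced q x (translate f x)].

(** The displacement caused by [f] depends only on the digits in a window containing the support of
    [f]. *)
Lemma measurable_piece q f : measurable (piece q f).
Proof.
rewrite (_ : piece q f = [set x | good x] `&` [set x | displaced q x (translate f x)]) //.
apply: measurableI; first exact: measurable_good.
have [n fn] := lamps_bound f; pose a := - n%:Z.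
apply: (@measurable_window _ _ _ (map (fun i => a + i%:Z) (iota 0 n.*2))) => x y xy.
have D z : displaced (wval a n.*2 (translate f z) - wval a n.*2 z) z (translate f z).
  by apply: displaced_window => i ilt; rewrite /translate fn ?add0r //; lia.
have E : window a n.*2 x = window a n.*2 y.
  by apply: eq_window => i il; apply: xy; apply: map_f; rewrite mem_iota.
have Ef : window a n.*2 (translate f x) = window a n.*2 (translate f y).
  apply: eq_window => i il; rewrite /translate xy //.
  by apply: map_f; rewrite mem_iota.
by move=> /(displaced_fun (D x)) <-; rewrite /wval E Ef; exact: D.
Qed.

(** Translation by [f] carries the piece onto one for the inverse odometer, so the images of the
    pieces partition the good set too. *)
Lemma piece_translate q f : piece q f = translate f @^-1` piece (- q) (- f).
Proof.
apply/seteqP; split=> x.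
  move=> [gx xf]; split; first exact: displaced_good xf gx.
  by rewrite translateK; exact: displacedN.
move=> [gx]; rewrite translateK => /[dup] /displacedN; rewrite opprK => xf /displaced_good.
by move=> /(_ gx).
Qed.

Variable hk : (1 < k)%N.

Let code := projT1 (cid (countable_lamps k)).

Let code_inj : injective code := projT2 (cid (countable_lamps k)).

(** Off the range of [code] the value is the default 0; unions run over that range only, lest the
    piece of 0 be repeated. *)
Let lamp j : lamps k := xget 0 [set f | code f = j].

Let codeK f : lamp (code f) = f.
Proof. by apply: code_inj; rewrite /lamp; case: xgetP => [g _|/(_ f)] /=. Qed.

Let lampK j : range code j -> code (lamp j) = j.
Proof. by move=> [f _ <-]; rewrite codeK. Qed.

Let piece_trivIset q : trivIset (range code) (fun j => piece q (lamp j)).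
Proof.
move=> i j /lampK iE /lampK jE [x [[gx xi] [_ xj]]]; rewrite -iE -jE; congr code.
exact: translate_inj (displaced_inj xi xj).
Qed.

Let pieceN_trivIset q : trivIset (range code) (fun j => piece q (- lamp j)).
Proof.
move=> i j /lampK iE /lampK jE [x [[gx xi] [_ xj]]]; rewrite -iE -jE; congr code.
by apply: oppr_inj; exact: translate_inj (displaced_inj xi xj).
Qed.

Let displaced_lamp q x y : displaced q x y -> exists f, y = translate f x.
Proof. by move=> [n [xy _]]; have [|f <-] := @lamps_diff _ x y; [exists n|exists f]. Qed.

Let piece_cover (q : Zinv k) :
  \bigcup_(j in range code) piece q (lamp j) = [set x | good x].
Proof.
apply/seteqP; split=> [x [j _ []] //|x gx].
have xq := odometerP hk q gx; have [f fE] := displaced_lamp xq.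
by exists (code f); [exists f|rewrite codeK; split=> //; rewrite -fE].
Qed.

Let pieceN_cover (q : Zinv k) :
  \bigcup_(j in range code) piece q (- lamp j) = [set x | good x].
Proof.
apply/seteqP; split=> [x [j _ []] //|x gx].
have xq := odometerP hk q gx; have [f fE] := displaced_lamp xq.
by exists (code (- f)); [exists (- f)|rewrite codeK opprK; split=> //; rewrite -fE].
Qed.

Let odometer_piece (q : Zinv k) (B : set X) :
  (odometer q @^-1` B) `&` [set x | good x] =
  \bigcup_(j in range code) translate (lamp j) @^-1` (piece (- (q : rat)) (- lamp j) `&` B).
Proof.
rewrite -(piece_cover q) setI_bigcupr; apply: eq_bigcupr => j _.
rewrite preimage_setI -piece_translate setIC; apply/seteqP.
by split=> x [[gx xj]]; rewrite /preimage /= (odometer_eq gx xj).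
Qed.

Let measurable_odometer_piece (q : Zinv k) (B : set X) j : measurable B ->
  measurable (translate (lamp j) @^-1` (piece (- (q : rat)) (- lamp j) `&` B) : set X).
Proof.
move=> mB; rewrite -[X in measurable X]setTI; apply: measurable_translate => //.
by apply: measurableI => //; exact: measurable_piece.
Qed.

Lemma measurable_odometer (q : Zinv k) : measurable_fun setT (odometer q : X -> X).
Proof.
move=> _ B mB; rewrite setTI -(setUIDK (_ @^-1` _) [set x | good x]).
apply: measurableU.
  rewrite odometer_piece; apply: bigcup_measurable => j _.
  exact: measurable_odometer_piece.
rewrite (_ : _ `\` _ = B `\` [set x | good x]).
  by apply: measurableD => //; exact: measurable_good.
by apply/seteqP; split=> x [] + bx; rewrite /preimage /= odometer_bad.
Qed.

(* On the good set the odometer agrees on each of countably many pieces with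
   a translation, and it maps these pieces onto pieces of the good set again. *)
Lemma odometer_preserves (q : Zinv k) : preserves mu (odometer q).
Proof.
move=> B mB; rewrite -measure_good; last first.
  by rewrite -[X in measurable X]setTI; exact: measurable_odometer.
rewrite odometer_piece measure_bigcup; last 2 first.
- by move=> j _; exact: measurable_odometer_piece.
- move=> i j iE jE [x [[/= xi _] [/= xj _]]]; have := @piece_trivIset (q : rat) i j iE jE; apply.
  by exists x; split; rewrite piece_translate.
rewrite -[RHS]measure_good // setIC -(pieceN_cover (- q)) setI_bigcupl measure_bigcup.
- apply: eq_eseriesr => j _; apply: (bernoulli_translate (lamp j)).
  by apply: measurableI => //; exact: measurable_piece.
- by move=> j _; apply: measurableI => //; exact: measurable_piece.
- move=> i j iE jE [x [[xi _] [xj _]]]; have := @pieceN_trivIset (- (q : rat)) i j iE jE; apply.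
  by exists x.
Qed.

End Coupling.

(** * The orbit equivalence coupling *)

Section OrbitEquivalenceCoupling.
Variables (R : realType) (k : nat) (hk : (1 < k)%N).
Local Notation X := (cfgB R k).
Local Notation mu := (bernoulli_cfg R k).

Lemma standard_borel_cfg : standard_borel R X.
Proof.
exists (cfg R k), id; split.
- exact: cfg_hausdorff.
- exact: cfg_dense.
- by exists id.
- by apply/seteqP; split=> [A mA|_ [A mA <-]]; [exists A|].
Qed.

Lemma lamplighter_action_free_pmp : free_pmp_action mu (@lamplighter_action k : _ -> X -> X).
Proof.
split.
- exact: lamplighter_action1.
- exact: lamplighter_actionM.
- move=> g; exact: measurableT_comp (measurable_translate _) (measurable_shift _).
- move=> g A mA; rewrite /pushforward -[RHS](bernoulli_translate g.1 mA).
  apply: (bernoulli_shift g.2 (A := translate g.1 @^-1` A)).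
  by rewrite -[X in measurable X]setTI; exact: measurable_translate.
- by apply: ae_of_good => x gx g; exact: lamplighter_free.
Qed.

Lemma BS_action_free_pmp : free_pmp_action mu (@BS_action k hk : _ -> X -> X).
Proof.
split.
- exact: BS_action1.
- exact: BS_actionM.
- move=> g; exact: measurableT_comp (measurable_odometer hk g.1) (measurable_shift _).
- move=> g A mA; rewrite /pushforward -[RHS](odometer_preserves hk g.1 mA).
  apply: (bernoulli_shift g.2 (A := odometer (g.1 : Zinv k) @^-1` A)).
  by rewrite -[X in measurable X]setTI; exact: measurable_odometer.
- by apply: ae_of_good => x gx g; exact: BS_free.
Qed.

Lemma lamplighter_BS_coupling :
  OE_coupling mu (@lamplighter_action k : _ -> X -> X) (@BS_action k hk : _ -> X -> X).
Proof.
split.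
- exact: standard_borel_cfg.
- exact: lamplighter_action_free_pmp.
- exact: BS_action_free_pmp.
- by apply: ae_of_good => x gx; exact: orbit_eq.
Qed.

End OrbitEquivalenceCoupling.

(** * Integrability *)

Section ExponentialTail.
Context d (T : measurableType d) (R : realType) (mu : {measure set T -> \bar R}).

Import HBNNSimple.

(** The integral of a nonnegative function is a supremum over the simple functions below it; this
    lets orbit distances be bounded pointwise. *)
Lemma le_nonneg_integral (f g : T -> \bar R) :
  (forall x, (0 <= f x)%E) -> (forall x, (f x <= g x)%E) ->
  (\int[mu]_x f x <= \int[mu]_x g x)%E.
Proof.
move=> f0 fg; have g0 x : (0 <= g x)%E by exact: le_trans (fg x).
rewrite !ge0_integralTE //; apply: ereal_sup_le => _ [h hf <-].
by exists h => //= x; exact: le_trans (hf x) (fg x).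
Qed.

Lemma nneseries_geometric_lty (a z : R) : 0 <= z < 1 ->
  (\sum_(n <oo) (a * z ^+ n)%:E < +oo)%E.
Proof.
move=> /andP[z0 z1].
have cv : cvgn (series (geometric a z)).
  by apply: is_cvg_geometric_series; rewrite ger0_norm.
rewrite (_ : (fun n => _) = EFin \o series (geometric a z)); last first.
  by apply/funext => n; rewrite /series /= -sumEFin.
by rewrite EFin_lim // ltry.
Qed.

(** The exponential is dominated by the sum over [s] of a (3/2)^s on [E s], whose integral is at
    most the convergent series of 2a (3/4)^s. *)
Lemma exp_integrable_of_tail (E : nat -> set T) (h : T -> \bar R) (A B : nat) :
  (forall s, measurable (E s)) -> (forall s, (mu (E s) <= (2 * 2^-1 ^+ s)%:E)%E) ->
  (forall x, exists2 s, E s x & (h x <= (A + B * s)%:R%:E)%E) ->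
  exists2 c : R, 0 < c & (\int[mu]_x expeR (h x * (c^-1)%:E) < +oo)%E.
Proof.
move=> mE tail hE; pose l : R := ln (3 / 2).
have l0 : 0 < l by apply: ln_gt0; lra.
(* Chosen so that exp(B/c) is at most 3/2; the successor keeps [c] positive when [B] is 0. *)
pose c := B.+1%:R / l; have c0 : 0 < c by rewrite divr_gt0.
pose a : R := expR (A%:R / c).
have bound s : expR ((A + B * s)%:R / c) <= a * (3 / 2) ^+ s.
  rewrite natrD natrM mulrDl expRD ler_pM2l ?expR_gt0 //.
  rewrite mulrAC -mulr_natr expRM_natr lerXn2r ?nnegrE ?expR_ge0 //.
  rewrite -[leRHS]lnK ?posrE // ler_expR -/l /c invf_div mulrA ler_pdivrMr // [leRHS]mulrC.
  by rewrite mul1r ler_pM2r // ler_nat.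
exists c => //.
pose g s x : \bar R := ((a * (3 / 2) ^+ s)%:E * (\1_(E s) x)%:E)%E.
have g0 s x : (0 <= g s x)%E.
  by rewrite mule_ge0 // lee_fin ?mulr_ge0 ?expR_ge0 ?exprn_ge0.
apply: (@le_lt_trans _ _ (\int[mu]_x (\sum_(s <oo) g s x))%E).
  apply: le_nonneg_integral => x; first exact: expeR_ge0.
  have [s Es hs] := hE x; apply: (@le_trans _ _ (g s x)).
    rewrite /g indicE mem_set // mule1;
    apply: le_trans (_ : (_ <= (expR ((A + B * s)%:R / c))%:E)%E) _.
      rewrite -[leRHS]/(expeR ((A + B * s)%:R / c)%:E) lee_expeR EFinM.
      by apply: lee_wpmul2r => //; rewrite lee_fin invr_ge0 ltW.
    by rewrite lee_fin.
  apply: (@le_trans _ _ (\sum_(0 <= i < s.+1) g i x)%E).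
    by rewrite big_nat_recr //= leeDr // sume_ge0.
  exact: nneseries_lim_ge.
rewrite integral_nneseries //; last first.
  move=> s; apply: emeasurable_funM => //; apply/measurable_EFinP.
  exact: measurable_indic.
apply: le_lt_trans (@nneseries_geometric_lty (a * 2) (3 / 4) ltac:(lra)).
apply: lee_nneseries => [s _ _|s _]; first by apply: integral_ge0.
rewrite ge0_integralZl_EFin //=; last 2 first.
- by apply/measurable_EFinP; exact: measurable_indic.
- by rewrite mulr_ge0 ?expR_ge0 ?exprn_ge0.
rewrite integral_indic // setIT.
apply: le_trans (_ : (_ <= (a * (3 / 2) ^+ s)%:E * (2 * 2^-1 ^+ s)%:E)%E) _.
  by apply: lee_wpmul2l => //; rewrite lee_fin mulr_ge0 ?expR_ge0 ?exprn_ge0.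
rewrite -EFinM lee_fin (_ : 3 / 4 = (3 / 2) * 2^-1 :> R); last by field.
by rewrite [X in _ <= _ * X]exprMn mulrACA.
Qed.

End ExponentialTail.

(** * Upper bounds on word lengths *)

Section WordLength.
Local Open Scope group_scope.
Variables (G : groupType) (S : set G).
Implicit Types (g h : G) (m n : nat).

(** Keeps the estimates in [nat], away from the infimum in [word_length]. *)
Definition word_bound g n := exists2 w, is_word S g w & (size w <= n)%N.

Lemma word_bound1 n : word_bound 1 n.
Proof. by exists [::]; split=> //; rewrite big_nil. Qed.

Lemma word_boundM g h m n :
  word_bound g m -> word_bound h n -> word_bound (g * h) (m + n).
Proof.
move=> [v [vS <-] vm] [w [wS <-] wn]; exists (v ++ w); last by rewrite size_cat leq_add.
split; last by rewrite big_cat.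
by move=> s /=; rewrite mem_cat => /orP[/vS|/wS].
Qed.

Lemma word_bound_le g m n : (m <= n)%N -> word_bound g m -> word_bound g n.
Proof. by move=> mn [w wS wm]; exists w => //; exact: leq_trans mn. Qed.

Lemma word_bound_ex : finite_sym_generating S ->
  exists l : G -> nat, forall g, word_bound g (l g).
Proof.
move=> [_ _ gen]; have /choice[w wP] := gen.
by exists (fun g => size (w g)) => g; exists (w g).
Qed.

Lemma word_length_le (R : realType) g n :
  word_bound g n -> (word_length R S g <= n%:R%:E)%E.
Proof.
move=> [w wS wn]; apply: le_trans (_ : (_ <= (size w)%:R%:E)%E) _.
  by apply: ereal_inf_lbound; exists w.
by rewrite lee_fin ler_nat.
Qed.

End WordLength.

Lemma orbit_dist_le (R : realType) d (X : measurableType d) (G : groupType)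
    (S : set G) (a : G -> X -> X) (g : G) (x : X) n :
  word_bound S g n -> (orbit_dist R S a x (a g x) <= n%:R%:E)%E.
Proof.
move=> gn; apply: le_trans (word_length_le R gn); apply: ereal_inf_lbound.
by exists g.
Qed.

(** * Word length in the lamplighter group *)

Section LamplighterLength.
Variables (k : nat) (S : set (lamplighter k)).
Hypothesis genS : finite_sym_generating S.
Implicit Types (f : lamps k) (n a : int).

Let dirac_subproof (c : 'Z_k) :
  (fun i : int => if i == 0 then c else 0) \in @finsupp_pred k.
Proof. by apply/finsupp_boundP; exists 1%N => -[[|i]|i]. Qed.

Let dirac c : lamps k := Lamps (dirac_subproof c).

Let elt f n : lamplighter k := (f, n).

Let eltM f g m n : (elt f m * elt g n)%g = elt (f + lamp_shift m g) (m + n).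
Proof. by []. Qed.

Lemma lamplighter_word_bound a n : exists A B : nat, forall (T : nat) f,
  (forall i, ~~ (a <= i < a + T%:Z) -> f i = 0) ->
  word_bound S ((f, n) : lamplighter k) (A + B * T).
Proof.
have [l lP] := word_bound_ex genS.
(* The cost of adding [c] to the current lamp and stepping right, maximised over the finitely many
   [c]. *)
pose M := \max_(c : 'Z_k) l (elt (dirac c) 1).
have lM c : word_bound S (elt (dirac c) 1) M.
  exact: word_bound_le (leq_bigmax c) (lP _).
have walk (T : nat) f : (forall i : int, ~~ (0 <= i < T%:Z) -> f i = 0) ->
    word_bound S (elt f T%:Z) (T * M).
  elim: T f => [|T IHT] f fT.
    rewrite (_ : f = 0); first exact: word_bound1.
    by apply/val_inj/funext => i /=; rewrite fT //; lia.
  pose u := lamp_shift T%:Z (dirac (f T%:Z)).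
  rewrite (_ : elt f _ = (elt (f - u) T%:Z * elt (dirac (f T%:Z)) 1)%g); last first.
    by rewrite eltM subrK -PoszD addn1.
  rewrite mulSnr; apply: word_boundM (lM _); apply: IHT => i ilt.
  rewrite -[LHS]/(f i - (if i - T%:Z == 0 then f T%:Z else 0)).
  by case: eqP => [/subr0_eq ->|iT]; rewrite ?subrr // subr0 fT //; lia.
have back (T : nat) : word_bound S (elt 0 (- T%:Z)) (T * l (elt 0 (-1))).
  elim: T => [|T IHT]; first exact: word_bound1.
  rewrite (_ : elt 0 _ = (elt 0 (- T%:Z) * elt 0 (-1))%g).
    by rewrite mulSnr; exact: word_boundM (lP _).
  rewrite eltM add0r; congr (_, _); last by lia.
  exact/val_inj/funext.
pose l1 := l (elt 0 a); pose l2 := l (elt 0 (n - a)); pose l3 := l (elt 0 (-1)).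
exists (l1 + l2)%N, (M + l3)%N => T f fT.
rewrite -[X in word_bound S X]/(elt f n).
have -> : elt f n = (elt 0 a * elt (lamp_shift (- a) f) T%:Z *
    elt 0 (- T%:Z) * elt 0 (n - a))%g.
  rewrite !eltM; congr (_, _); last by lia.
  by apply/val_inj/funext => i /=; rewrite !addr0 add0r opprK subrK.
have wf : word_bound S (elt (lamp_shift (- a) f) T%:Z) (T * M).
  by apply: walk => i ilt /=; rewrite fT //; lia.
have := word_boundM (word_boundM (word_boundM (lP (elt 0 a)) wf) (back T)) (lP (elt 0 (n - a))).
by apply: word_bound_le; rewrite -/l1 -/l2 -/l3 mulnDl ![(_ * T)%N]mulnC; lia.
Qed.

End LamplighterLength.

(** * The essential bound and the exponential bound *)

Section Integrability.
Variables (R : realType) (k : nat) (hk : (1 < k)%N).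
Local Notation K := (Zp_trunc k).+2.
Local Notation X := (cfgB R k).
Local Notation mu := (bernoulli_cfg R k).
Local Notation aG := (@lamplighter_action k : lamplighter k -> X -> X).
Local Notation aL := (@BS_action k hk : BS1 hk -> X -> X).

(* A fixed lamp configuration [f] can change the value of the window supporting
   it by finitely many amounts only. *)
Lemma lamplighter_BS_Linfty (SL : set (BS1 hk)) (g : lamplighter k) :
  finite_sym_generating SL ->
  (ess_sup mu (fun x => orbit_dist R SL aL x (aG g x)) < +oo)%E.
Proof.
case: g => [f n] /word_bound_ex[l lP]; have [m fm] := lamps_bound f.
(* [Q] sends the window values after and before the change to the amount added; [M] is a maximum
   over the finitely many such pairs. *)
have /choice[Q QE] : forall w : nat * nat, exists q : Zinv k,
    q = w.1%:R * K%:R ^ (- m%:Z) - w.2%:R * K%:R ^ (- m%:Z) :> rat.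
  move=> w; pose q : rat := w.1%:R * K%:R ^ (- m%:Z) - w.2%:R * K%:R ^ (- m%:Z).
  suff qP : q \in Zinv_pred k by exists (MkZinv qP).
  apply/asboolP; exists m; rewrite /q -mulrBl -exprnN -mulrA Zp_cast //.
  by rewrite mulVf ?mulr1 ?rpredB ?rpred_nat // expf_neq0 // pnatr_eq0 -lt0n ltnW.
pose elt q : BS1 hk := (q, n).
pose M := \max_(w < K ^ m.*2) \max_(w' < K ^ m.*2) l (elt (Q (w : nat, w' : nat))).
apply: (@le_lt_trans _ _ M%:R%:E); last exact: ltry.
apply/ess_supP; apply: ae_of_good => x gx.
pose z := shift n x; pose w (y : int -> 'Z_k) : nat := window (- m%:Z) m.*2 y.
have wlt y : (w y < K ^ m.*2)%N by rewrite -(window_compl (- m%:Z) m.*2 y) ltnS leq_addr.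
have D : displaced (Q (w (translate f z), w z) : rat) z (translate f z).
  rewrite QE; apply: displaced_window => i ilt.
  by rewrite /translate fm ?add0r //; lia.
have -> : aG (f, n) x = aL (elt (Q (w (translate f z), w z))) x.
  by apply/esym/odometer_eq => //; exact: good_shift.
apply: orbit_dist_le; apply: word_bound_le (lP _).
apply: leq_trans (leq_bigmax (Ordinal (wlt (translate f z)))).
exact: (leq_bigmax (F := fun w' : 'I_(K ^ m.*2) => l (elt (Q (_, w' : nat))))
  (Ordinal (wlt z))).
Qed.

(* Adding [q] changes the digits beyond a fixed place only as far as a run of
   digits [0] (borrowing) or [K - 1] (carrying) extends from there. *)
Lemma BS_lamplighter_exp (SG : set (lamplighter k)) (g : BS1 hk) :
  finite_sym_generating SG ->
  exists2 c : R, 0 < c &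
    (\int[mu]_x expeR (orbit_dist R SG aG x (aL g x) * (c^-1)%:E) < +oo)%E.
Proof.
case: g => [q n] genS.
have [j [m qE]] : exists (j : nat) (m : int), m%:~R / K%:R ^+ j = q :> rat.
  case: q => q /= /asboolP[j /intrP[m qm]]; exists j, m.
  by rewrite -qm Zp_cast // mulfK // expf_neq0 // pnatr_eq0 -lt0n ltnW.
pose b := `|m|%N; have mb : (`|m| < K ^ b)%N by exact: ltn_expl.
have [A [B AB]] := lamplighter_word_bound genS (- j%:Z) n.
pose I s := [seq b%:Z - j%:Z + t%:Z | t <- iota 0 s].
pose run (c : 'Z_k) s : set X := fin_cylinder (I s) (fun=> c).
(* The [s] places from b - j on all carry the digit 0 or all carry K - 1, an event of measure at
   most 2 K^(-s). *)
pose E s : set X := shift n @^-1` (run ord0 s `|` run ord_max s).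
have mrun c s : measurable (run c s) by exact: measurable_fin_cylinder.
(* On the matching event the changed digits lie in a window of length b + s + 1, so the length is at
   most A + B (b + s + 1). *)
apply: (@exp_integrable_of_tail _ _ _ _ E _ (A + B * b.+1) B).
- move=> s; rewrite -[X in measurable X]setTI; apply: measurable_shift => //.
  exact: measurableU.
- move=> s; rewrite [leLHS](@bernoulli_shift R k n) //; last exact: measurableU.
  apply: (@le_trans _ _ (mu (run ord0 s) + mu (run ord_max s))%E); first exact: measureU2.
  have Iu : uniq (I s) by rewrite map_inj_uniq ?iota_uniq // => t u /addrI [].
  have mI c : mu (run c s) = (K%:R ^- s)%:E.
    by rewrite bernoulli_fin_cylinder // size_map size_iota.
  rewrite !mI -EFinD lee_fin -mulr2n -[leLHS]mulr_natl ler_pM2l //.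
  rewrite exprVn lef_pV2 ?posrE ?exprn_gt0 //.
  by rewrite lerXn2r ?nnegrE // ler_nat.
move=> x; have [gx|bx] := pselect (good x); last first.
  exists 0%N; first by left => i.
  (* The odometer is the identity here, so only the shift remains and [s] = 0 suffices. *)
  have -> : aL (q, n) x = aG (0, n) x.
    rewrite /BS_action odometer_bad; last by rewrite good_shiftE.
    by apply/funext => i; rewrite /lamplighter_action /translate /= add0r.
  by apply: orbit_dist_le; rewrite muln0 addn0; exact: AB.
pose z := shift n x; have gz : good z by exact: good_shift.
pose P s := `[< exists t1 t2, [/\ (t1 < s)%N, (t2 < s)%N,
  z (b%:Z - j%:Z + t1%:Z) <> ord0 & z (b%:Z - j%:Z + t2%:Z) <> ord_max] >].
have exP : exists s, P s.
  have [t1] := gz (b%:Z - j%:Z) 0%N ord0; have [t2] := gz (b%:Z - j%:Z) 0%N ord_max.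
  rewrite !mul1n => zt2 zt1; exists (t1 + t2).+1; apply/asboolP; exists t1, t2.
  by split=> //; rewrite ltnS ?leq_addl ?leq_addr.
(* [s.+1] is the least number of places showing both a nonzero digit and one other than K - 1; by
   minimality the first [s] form a run, so [x] lies in [E s]. *)
case: (ex_minnP exP) => -[|s] /asboolP[t1 [t2 []]] // t1s t2s zt1 zt2 minP.
exists s.
  apply: contrapT => /not_orP[/existsNP[i1 /not_implyP[/mapP[u1]]]].
  rewrite mem_iota add0n => /= u1s -> zu1 /existsNP[i2 /not_implyP[/mapP[u2]]].
  rewrite mem_iota add0n => /= u2s -> zu2.
  suff /minP : P s by rewrite ltnn.
  by apply/asboolP; exists u1, u2.
have [y [zy qzy]] := displaced_ex mb t1s t2s zt1 zt2; rewrite qE in qzy.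
have [f fz] : exists f : lamps k, translate f z = y.
  by apply: lamps_diff; case: qzy => N [? _]; exists N.
have -> : aL (q, n) x = aG (f, n) x by rewrite /lamplighter_action /= fz; exact: odometer_eq.
apply: orbit_dist_le; rewrite -addnA -mulnDr addSnnS; apply: AB => i ilt.
by have := zy i ilt; rewrite -fz => E0; apply: (addIr (z i)); rewrite add0r; exact/esym.
Qed.

End Integrability.

Theorem theorem10 (R : realType) (k : nat) (hk : (2 <= k)%N) :
  exists (d : measure_display) (X : measurableType d) (mu : probability X R)
         (aG : lamplighter k -> X -> X) (aL : BS1 hk -> X -> X),
    OE_coupling mu aG aL /\
    (forall (SG : set (lamplighter k)) (SL : set (BS1 hk)),
       finite_sym_generating SG -> finite_sym_generating SL ->
       Linfty_exp_integrable mu SG SL aG aL).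
Proof.
exists _, (cfgB R k), (bernoulli_cfg R k), (@lamplighter_action k), (@BS_action k hk).
split=> [|SG SL genG genL]; first exact: lamplighter_BS_coupling.
by split=> [g|l]; [exact: lamplighter_BS_Linfty|exact: BS_lamplighter_exp].
Qed.
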